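(* Let $G$ be a group and let $R=\bigoplus_{\sigma\in G}R_\sigma$ be a $G$-graded ring. Then the following assertions are equivalent: (1) $R$ is von Neumann gr-regular. (2) For every $\sigma\in G$, $R(\sigma)$ is $R$-regular in the category $R\text{-}gr$ of graded left $R$-modules.
   Context: For objects $U, M$ of a category, $M$ is called $U$-regular if every morphism $f:U\to M$ has a generalized inverse, i.e. a morphism $h:M\to U$ with $f=f\circ h\circ f$ and $h=h\circ f\circ h$ (equivalently, for every $f:U\to M$ there is $g:M\to U$ with $f=f\circ g\circ f$). Rings are associative with unit. $R\text{-}gr$ has as morphisms the $R$-linear maps $f:M\to N$ with $f(M_\tau)\subseteq N_\tau$ for all $\tau\in G$. The graded ring $R$ is von Neumann gr-regular if for every $\sigma\in G$ and every $x_\sigma\in R_\sigma$ there exists $y\in R$ such that $x_\sigma=x_\sigma y x_\sigma$. For a graded left $R$-module $M$ and $\sigma\in G$, the $\sigma$-suspension $M(\sigma)$ is the graded $R$-module equal to $M$ as an $R$-module, with grading $M(\sigma)_\tau=M_{\tau\sigma}$ for $\tau\in G$. *)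

(* Defs.v *)
From HB Require Import structures.
From mathcomp Require Import all_boot all_order all_algebra.
From mathcomp Require Import boolp classical_sets functions cardinality fsbigop.

Set Implicit Arguments.
Unset Strict Implicit.
Unset Printing Implicit Defensive.

Import GRing.Theory.
Local Open Scope classical_set_scope.
Local Open Scope ring_scope.

Record category := Category {
  ob :> Type;
  hom : ob -> ob -> Type;
  idm : forall A, hom A A;
  (* [comp g f] is [g] after [f] *)
  comp : forall A B C, hom B C -> hom A B -> hom A C;
  comp_idl : forall A B (f : hom A B), comp (idm B) f = f;
  comp_idr : forall A B (f : hom A B), comp f (idm A) = f;
  comp_assoc : forall A B C D (h : hom C D) (g : hom B C) (f : hom A B),
    comp h (comp g f) = comp (comp h g) f
}.
Arguments hom {c} A B.
Arguments idm {c} A.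
Arguments comp {c A B C} g f.

Definition generalized_inverse (C : category) (U M : C)
    (f : hom U M) (h : hom M U) : Prop :=
  f = comp (comp f h) f /\ h = comp (comp h f) h.

Definition regular_ob (C : category) (U M : C) : Prop :=
  forall f : hom U M, exists h : hom M U, generalized_inverse f h.

Definition additive_subgroup (V : zmodType) (A : set V) : Prop :=
  A 0 /\ forall x y, A x -> A y -> A (x - y).

(* Every element of V is in a unique way a finitely supported sum of
   components. The finiteness condition cannot be dropped: a sum over an
   infinite support has the default value 0. *)
Definition internal_direct_sum (I : choiceType) (V : zmodType)
    (V_ : I -> set V) : Prop :=
  forall x : V, exists! c : I -> V,
    [/\ forall i, V_ i (c i),
        finite_set [set i | c i != 0] &
        x = \sum_(i \in [set: I]) c i].

Record graded_ring (G : groupType) := GradedRing {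
  gring_sort :> pzRingType;
  gring_comp : G -> set gring_sort;
  gring_subgroup : forall s, additive_subgroup (gring_comp s);
  gring_direct : internal_direct_sum gring_comp;
  gring_mul : forall s t x y,
    gring_comp s x -> gring_comp t y -> gring_comp (s * t)%g (x * y)
}.
Arguments gring_comp {G} R s : rename.

Record graded_module (G : groupType) (R : graded_ring G) := GradedModule {
  gmod_sort :> lmodType R;
  gmod_comp : G -> set gmod_sort;
  gmod_subgroup : forall s, additive_subgroup (gmod_comp s);
  gmod_direct : internal_direct_sum gmod_comp;
  gmod_scale : forall s t a x,
    gring_comp R s a -> gmod_comp t x -> gmod_comp (s * t)%g (a *: x)
}.
Arguments gmod_comp {G R} M s : rename.

Definition gr_regular (G : groupType) (R : graded_ring G) : Prop :=
  forall (s : G) (x : R), gring_comp R s x -> exists y : R, x = x * y * x.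

Record gr_hom (G : groupType) (R : graded_ring G) (M N : graded_module R) :=
  GrHom {
    gr_fun :> {linear M -> N};
    gr_homP : forall t x, gmod_comp M t x -> gmod_comp N t (gr_fun x)
  }.

Section GrCategory.
Variables (G : groupType) (R : graded_ring G).

Lemma gr_hom_eq (M N : graded_module R) (f g : gr_hom M N) : f =1 g -> f = g.
Proof.
case: f g => [f fP] [g gP] /= fg.
have {}fg : f = g.
  case: f g fg {fP gP} => [f cf] [g cg] /= /funext fg; subst g.
  by congr GRing.Linear.Pack; case: cf cg => [[?] [?]] [[?] [?]];
    congr GRing.Linear.Class; congr (_ _); apply: Prop_irrelevance.
by subst g; congr GrHom; apply: Prop_irrelevance.
Qed.

Definition gr_id (M : graded_module R) : gr_hom M M :=
  @GrHom G R M M idfun (fun t x Mx => Mx).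

Definition gr_comp (M N P : graded_module R)
    (g : gr_hom N P) (f : gr_hom M N) : gr_hom M P :=
  @GrHom G R M P (g \o f) (fun t x Mx => gr_homP g (gr_homP f Mx)).

Definition R_gr : category :=
  @Category (graded_module R) (@gr_hom G R) gr_id gr_comp
    (fun M N f => @gr_hom_eq M N (gr_comp (gr_id N) f) f (fun=> erefl))
    (fun M N f => @gr_hom_eq M N (gr_comp f (gr_id M)) f (fun=> erefl))
    (fun M N P Q h g f => @gr_hom_eq M Q (gr_comp h (gr_comp g f))
       (gr_comp (gr_comp h g) f) (fun=> erefl)).

Definition gr_self : graded_module R :=
  @GradedModule G R (R^o) (gring_comp R) (@gring_subgroup G R)
    (@gring_direct G R) (@gring_mul G R).

Section Suspension.
Variables (M : graded_module R) (s : G).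

Let susp_comp (t : G) : set M := gmod_comp M (t * s)%g.

Lemma susp_direct : internal_direct_sum susp_comp.
Proof.
have bij (u : G) : bijective (fun t : G => (t * u)%g).
  by exists (fun t => (t * u^-1)%g) => t; rewrite ?mulgK ?mulgVK.
have fin (u : G) (c : G -> M) : finite_set [set t | c t != 0] ->
    finite_set [set t | c (t * u)%g != 0].
  move=> fc; apply: (@sub_finite_set _ _
      ((fun t => (t * u^-1)%g) @` [set t | c t != 0])); last exact: finite_image.
  by move=> t /= ct; exists (t * u)%g => //; rewrite mulgK.
move=> x; have [c [[Mc fc xc] uc]] := gmod_direct x.
exists (fun t => c (t * s)%g); split.
  split; [by move=> t; exact: Mc | exact: fin |].
  by rewrite xc (reindex_fsbigT (fun t : G => (t * s)%g)).
move=> d [Md fd xd].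
have cd : c = (fun t => d (t * s^-1)%g).
  apply: uc; split; [|exact: fin|].
    by move=> t; have := Md (t * s^-1)%g; rewrite /susp_comp mulgVK.
  by rewrite xd (reindex_fsbigT (fun t : G => (t * s^-1)%g)).
by apply: funext => t; rewrite cd mulgK.
Qed.

Lemma susp_scale (r t : G) (a : R) (x : M) :
  gring_comp R r a -> susp_comp t x -> susp_comp (r * t)%g (a *: x).
Proof. by move=> Ra Mx; rewrite /susp_comp -mulgA; exact: gmod_scale. Qed.

Definition suspension : graded_module R :=
  @GradedModule G R M susp_comp (fun t => gmod_subgroup M (t * s)%g)
    susp_direct susp_scale.

End Suspension.
End GrCategory.
Arguments gr_self {G} R.

(* Main.v *)
(** A morphism of graded modules out of [R] is right multiplication by the
    image of [1], which has degree [1]. Hence morphisms from [R] to [R(s)] are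
    the right multiplications by elements of [R_s], and morphisms from [R(s)]
    to [R] those by elements of degree [s^-1]. The only point is that
    [x = x * y * x] with [x] of degree [s] remains true when [y] is replaced by
    its component of degree [s^-1], since [x * _ * x] maps distinct components
    to distinct components. *)
From HB Require Import structures.
Require Import Defs.
From mathcomp Require Import all_boot all_order all_algebra.
From mathcomp Require Import boolp classical_sets functions cardinality fsbigop.
From mathcomp Require Import finmap.

Set Implicit Arguments.
Unset Strict Implicit.
Unset Printing Implicit Defensive.

Import GRing.Theory.
Local Open Scope classical_set_scope.
Local Open Scope ring_scope.

(** Both sums reduce to the finite support of [c], which contains that of [phi \o c]. For an
    infinite support the left sum would default to 0, whereas the right one might not. *)
Lemma raddf_fsum (I : choiceType) (V W : zmodType) (phi : {additive V -> W})
    (c : I -> V) : finite_set [set i | c i != 0] ->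
  phi (\sum_(i \in [set: I]) c i) = \sum_(i \in [set: I]) phi (c i).
Proof.
move=> fc.
have c0 i : i \notin fset_set [set i | c i != 0] -> c i = 0.
  by rewrite in_fset_set// notin_setE/= => /negP; rewrite negbK => /eqP.
rewrite !(fsbigTE (fset_set [set i | c i != 0])) ?raddf_sum//.
by move=> i /c0 ->; rewrite raddf0.
Qed.

Lemma finite_support_can (I J : choiceType) (V W : zmodType) (g : I -> J)
    (g' : J -> I) (phi : {additive V -> W}) (c : I -> V) :
  cancel g' g -> finite_set [set i | c i != 0] ->
  finite_set [set j | phi (c (g' j)) != 0].
Proof.
move=> g'K fc; apply: (sub_finite_set _ (finite_image g fc)) => j /= cj.
by exists (g' j) => //; apply: contraNneq cj => ->; rewrite raddf0.
Qed.

Section DirectSum.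
Variables (I : choiceType) (V : zmodType) (V_ : I -> set V).
Hypothesis V_sub : forall i, additive_subgroup (V_ i).
Hypothesis V_dir : internal_direct_sum V_.

Lemma component_homogeneous (i : I) (x : V) (c : I -> V) :
  V_ i x -> (forall j, V_ j (c j)) -> finite_set [set j | c j != 0] ->
  x = \sum_(j \in [set: I]) c j -> c i = x.
Proof.
move=> Vx Vc fc xc; have [b [_ ub]] := V_dir x.
have <- : b = c by exact: ub.
(* The family concentrated at [i] also decomposes [x], so uniqueness identifies it with [c]. *)
rewrite (ub (fun j => if j == i then x else 0)) ?eqxx//; split.
- by move=> j; case: eqP => [->//|_]; case: (V_sub j).
- apply: (@sub_finite_set _ _ [set i]); last exact: finite_set1.
  by move=> j /=; case: (j =P i) => //; rewrite eqxx.
- rewrite (@fsbigTE _ _ _ _ [fset i]%fset) ?big_seq_fset1 ?eqxx// => j.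
  by rewrite inE => /negPf ->.
Qed.

(** Since [phi] permutes the degrees by the bijection [g], the family [phi (c (g' j))] decomposes
    [phi x], which is itself homogeneous of degree [g i]. *)
Lemma raddf_component (g g' : I -> I) (phi : {additive V -> V}) (i : I) (x : V)
    (c : I -> V) :
  cancel g g' -> cancel g' g ->
  (forall j y, V_ j y -> V_ (g j) (phi y)) ->
  (forall j, V_ j (c j)) -> finite_set [set j | c j != 0] ->
  x = \sum_(j \in [set: I]) c j -> V_ (g i) (phi x) -> phi (c i) = phi x.
Proof.
move=> gK g'K phiV Vc fc xc Vx.
have := @component_homogeneous (g i) (phi x) (fun j => phi (c (g' j))) Vx.
rewrite gK; apply.
- by move=> j; rewrite -[in V_ j](g'K j); apply: phiV.
- exact: finite_support_can g'K fc.
- rewrite xc raddf_fsum// (reindex_fsbigT g')//.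
  by exists g.
Qed.

End DirectSum.

Section GradedRing.
Variables (G : groupType) (R : graded_ring G).

(** The component [e] of 1 in degree 1 satisfies [x * e = x] for homogeneous [x], by comparing
    degrees in [x * 1 = x]. Summing over the components of 1 gives [e = 1 * e = 1]. *)
Lemma gring_comp1 : gring_comp R 1%g 1.
Proof.
have [c [[Rc fc c1] _]] := @gring_direct G R 1.
have homE s x : gring_comp R s x -> x * c 1%g = x.
  move=> Rx; rewrite -[RHS]mulr1.
  apply: (@raddf_component G R _ (@gring_subgroup G R) (@gring_direct G R)
    (fun t => s * t)%g (fun t => s^-1 * t)%g (x \*o idfun) 1%g 1 c) => //.
  - exact: mulKg.
  - exact: mulVKg.
  - by move=> t y Ry; apply: gring_mul.
  - by rewrite /= mulr1 mulg1.
suff <- : c 1%g = 1 by [].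
rewrite -[c 1%g in LHS]mul1r {1}c1.
have /= -> := @raddf_fsum G R R (c 1%g \o* idfun) c fc.
by rewrite [RHS]c1; apply: eq_fsbigr => t _; apply: homE (Rc t).
Qed.

Lemma gr_regular_homogeneous (s : G) (x : R) : gr_regular R ->
  gring_comp R s x -> exists2 y, gring_comp R s^-1%g y & x = x * y * x.
Proof.
move=> regR Rx; have [y xyx] := regR s x Rx.
have [c [[Rc fc yc] _]] := @gring_direct G R y.
exists (c s^-1%g) => //.
have -> : x * c s^-1%g * x = x * y * x; last by [].
apply: (@raddf_component G R _ (@gring_subgroup G R) (@gring_direct G R)
  (fun t => s * t * s)%g (fun t => s^-1 * (t * s^-1))%g
  (x \o* (x \*o idfun)) s^-1%g y c) => //.
- by move=> t; rewrite mulgK mulKg.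
- by move=> t; rewrite mulVKg mulgVK.
- by move=> t z Rz; apply: gring_mul => //; apply: gring_mul.
- by rewrite /= -xyx mulgV mul1g.
Qed.

Lemma mulr_linear (x : R) : linear (fun r : R^o => r * x : R^o).
Proof. by move=> a u v; rewrite mulrDl -mulrA. Qed.

(** A suspension keeps the underlying module, so this one map serves for morphisms both into and out
    of [R(s)]. *)
Definition mulr_lin (x : R) : {linear R^o -> R^o} :=
  HB.pack (fun r : R^o => r * x : R^o)
    (GRing.isLinear.Build _ _ _ _ _ (mulr_linear x)).

Definition gr_mulr (s : G) (x : R) (Rx : gring_comp R s x) :
    gr_hom (gr_self R) (suspension (gr_self R) s) :=
  @GrHom G R (gr_self R) (suspension (gr_self R) s) (mulr_lin x)
    (fun t r Rr => gring_mul Rr Rx).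

Lemma susp_mulr_homog (s : G) (x : R) (Rx : gring_comp R s^-1%g x) (t : G)
    (r : R) :
  gmod_comp (suspension (gr_self R) s) t r ->
  gmod_comp (gr_self R) t (mulr_lin x r).
Proof. by move=> Rr; rewrite -(mulgK s t); apply: gring_mul. Qed.

Definition gr_susp_mulr (s : G) (x : R) (Rx : gring_comp R s^-1%g x) :
    gr_hom (suspension (gr_self R) s) (gr_self R) :=
  @GrHom G R (suspension (gr_self R) s) (gr_self R) (mulr_lin x)
    (susp_mulr_homog Rx).

Lemma linear_regularE (f : {linear R^o -> R^o}) (r : R) : f r = r * f 1.
Proof. by rewrite -[r in LHS]mulr1; exact: linearZ. Qed.

End GradedRing.

Theorem theorem5p2 (G : groupType) (R : graded_ring G) :
  gr_regular R <->
  (forall s : G, @regular_ob (R_gr R) (gr_self R) (suspension (gr_self R) s)).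
Proof.
split=> [regR s f | regR s x Rx].
- have fE (r : R) : gr_fun f r = r * (gr_fun f 1 : R) :> R.
    exact: (linear_regularE (gr_fun f)).
  (* As 1 has degree 1, its image lies in the degree 1 part of [R(s)], which is [R_s]. *)
  have := gr_homP f (gring_comp1 R).
  rewrite [gmod_comp _ _ _]/(gring_comp R (1 * s)%g _) mul1g => Rx.
  have [y Ry xyx] := gr_regular_homogeneous regR Rx.
  move: {Rx}(gr_fun f 1 : R) Rx xyx fE => x Rx xyx fE.
  (* Multiplication by [y] gives only [f = f h f]; passing to [y * x * y] also yields
     [h = h f h]. *)
  have Rz : gring_comp R s^-1%g (y * x * y).
    by rewrite -[s^-1%g]mul1g -(mulVg s); do !apply: gring_mul.
  have xyxA u : x * (y * (x * u)) = x * u by rewrite !mulrA -xyx.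
  exists (gr_susp_mulr Rz); split; apply: gr_hom_eq => r /=.
  + by rewrite !fE -!mulrA; congr (r * _); rewrite !mulrA -!xyx.
  + by rewrite !fE -!mulrA !xyxA.
- have [h [fhf _]] := regR s (gr_mulr Rx).
  exists (gr_fun h (1 : R)).
  (* Evaluating [f = f h f] at 1 gives [x = h x * x], and [h x = x * h 1] by linearity. *)
  have : gr_fun (gr_mulr Rx) (1 : R) = gr_fun h (1 * x : R) * x :> R.
    by rewrite [in LHS]fhf.
  by rewrite /= !mul1r (linear_regularE (gr_fun h) x).
Qed.
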